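(* There exist universal positive constants $\kappa$ and $c$ such that the following holds for any $\alpha\in(0,1)$, any $K\ge 1$ and any $\theta\in\Theta_K$. On the event $\mathcal{B}_{1-\alpha}$, of probability higher than $1-\alpha$, and for any change-point vector $\tau$ (possibly depending on the data $Y$), the pruned vector $\mathcal{P}(\tau)$ satisfies: (a) $\mathcal{P}(\tau)$ does not detect any spurious change-point: $$\left|\{\mathcal{P}(\tau)\}\cap\left(\tfrac{\tau^*_{k-1}+\tau^*_k}{2},\tfrac{\tau^*_k+\tau^*_{k+1}}{2}\right]\right|\leq1\ \text{ for all }k\in\{2,\dots,K-1\},\quad \left|\{\mathcal{P}(\tau)\}\cap\left[2,\tfrac{\tau_1^*+\tau_2^*}{2}\right]\right|\leq1,\quad\left|\{\mathcal{P}(\tau)\}\cap\left(\tfrac{\tau^*_{K-1}+\tau^*_K}{2},n\right]\right|\leq1.$$ (b) Any $(\kappa,\zeta_{1-\alpha}^2)$-high-energy change-point $\tau_k^*$ such that $$d_{H,1}(\tau,\tau_k^* )<\frac{\min(\tau_k^*-\tau_{k-1}^*,\ \tau_{k+1}^*-\tau_k^* )}{8}$$ also satisfies $$d_{H,1}(\mathcal{P}(\tau),\tau_k^* )\leq\max\left\{2\,d_{H,1}(\tau,\tau_k^* ),\ c\,\frac{\log(n\Delta_k^2)+\zeta_{1-\alpha}^2}{\Delta_k^2}\right\}.$$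
   Context: Model: $Y_i=\theta_i+\epsilon_i$, $i=1,\dots,n$, where $\epsilon_1,\dots,\epsilon_n$ are independent, mean-zero and satisfy $\mathbb{E}[e^{t\epsilon_i}]\leq e^{t^2/2}$ for all $t\in\mathbb{R}$. $\Theta_K\subset\mathbb{R}^n$ is the set of vectors with exactly $K$ change-points: there are integers $1=\tau_0^*<\tau_1^*<\dots<\tau_K^*<\tau_{K+1}^*=n+1$ and reals $\mu_1,\dots,\mu_{K+1}$ with $\mu_k\neq\mu_{k+1}$ and $\theta_i=\mu_k$ for $\tau_{k-1}^*\leq i<\tau_k^*$; $\Delta_k=\mu_{k+1}-\mu_k$. The change-point $\tau_k^*$ is $(\kappa,q)$-high-energy if $$|\Delta_k|\sqrt{\frac{(\tau^*_k-\tau^*_{k-1})(\tau^*_{k+1}-\tau^*_k)}{\tau^*_{k+1}-\tau^*_{k-1}}}>\kappa\sqrt{2\log\left(\frac{n(\tau^*_{k+1}-\tau^*_{k-1})}{(\tau^*_{k+1}-\tau^*_k)(\tau^*_k-\tau^*_{k-1})}\right)+q}.$$ $\mathcal{T}_3$ is the set of integer triplets $t=(t_1,t_2,t_3)$ with $1\leq t_1<t_2<t_3\leq n+1$. For such $t$ put $S(t)=\sqrt{\frac{(t_2-t_1)(t_3-t_2)}{t_3-t_1}}$, $\lambda(t)=\sqrt{2\log\left(\frac{n(t_3-t_1)}{(t_3-t_2)(t_2-t_1)}\right)}$, $C(Y,t)=\left[\frac{\sum_{i=t_2}^{t_3-1}Y_i}{t_3-t_2}-\frac{\sum_{i=t_1}^{t_2-1}Y_i}{t_2-t_1}\right]S(t)$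 (CUSUM statistic), and $N(t)$ the same expression with $\epsilon_i$ in place of $Y_i$. $\zeta_{1-\alpha}$ is the smallest number such that $\mathbb{P}\left[\sup_{t\in\mathcal{T}_3}(|N(t)|-\lambda(t))>\zeta_{1-\alpha}\right]\leq\alpha$, and $\mathcal{B}_{1-\alpha}=\{|N(t)|\leq\lambda(t)+\zeta_{1-\alpha}\ \forall t\in\mathcal{T}_3\}$. For $\tau\in\{2,\dots,n\}$ and a positive integer $r$ (or $r=+\infty$), $t^{(\tau,r)}=(\max(\tau-r,1),\tau,\min(\tau+r,n+1))$. Let $\widehat r_\tau=\min\{r\geq1:\ |C(Y,t^{(\tau,r)})|>\lambda(t^{(\tau,r)})+\zeta_{1-\alpha}\}$ (with $\min\emptyset=+\infty$) and $\underline{I}_\tau=[t_1^{(\tau,\widehat r_\tau)}+1,\ t_3^{(\tau,\widehat r_\tau)}-1]$. A change-point vector is a strictly increasing vector of integers in $\{2,\dots,n\}$ of length $|\tau|$; $\{\tau\}$ is the set of its entries; $d_{H,1}(\tau,\tau')=\min_i|\tau_i-\tau'|$ ($+\infty$ if $\tau$ is empty). Pruning: order the entries of $\tau$ as $\tau_{(1)},\dots,\tau_{(|\tau|)}$ with $\widehat r_{\tau_{(1)}}\geq\widehat r_{\tau_{(2)}}\geq\dots\geq\widehat r_{\tau_{(|\tau|)}}$. Start with $\mathcal{P}(\tau)=\tau$; for $l=1,\dots,|\tau|-1$, remove $\tau_{(l)}$ from $\mathcal{P}(\tau)$ if $\widehat r_{\tau_{(l)}}=\infty$ or if $\underline{I}_{\tau_{(l)}}$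 intersects $\bigcup_{j>l}\underline{I}_{\tau_{(j)}}$. The output is $\mathcal{P}(\tau)$. *)

(* Defs.v *)
From HB Require Import structures.
From mathcomp Require Import all_boot all_order all_algebra.
From mathcomp Require Import all_classical all_reals all_analysis.

Set Implicit Arguments.
Unset Strict Implicit.
Unset Printing Implicit Defensive.

Import Order.TTheory GRing.Theory Num.Theory.
Import numFieldNormedType.Exports.

Local Open Scope classical_set_scope.
Local Open Scope ring_scope.

(* Positions run over 1, ..., n, whereas an ordinal i : 'I_n runs over
   0, ..., n - 1: the entry of a vector at position p is its value at the
   ordinal i with i.+1 = p. *)

Section Noise.
Context d (Omega : measurableType d) (R : realType) (P : probability Omega R).
Variable n : nat.
Implicit Type eps : 'I_n -> {RV P >-> R}.

Definition mutually_independent eps : Prop :=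
  forall (J : {set 'I_n}) (B : 'I_n -> set R),
    (forall i, measurable (B i)) ->
    P (\bigcap_(i in [set` J]) (eps i @^-1` B i)) =
    (\prod_(i in J) P (eps i @^-1` B i))%E.

Definition centered eps : Prop :=
  forall i, P.-integrable setT (EFin \o eps i) /\ 'E_P[eps i]%E = 0%E.

Definition subgaussian eps : Prop :=
  forall i (t : R), ('M_P (eps i) t <= (expR (t ^+ 2 / 2))%:E)%E.

End Noise.

Section Model.
Context {R : realType}.

(* The change-points are taus 1, ..., taus K, with the conventions
   taus 0 = 1 and taus K.+1 = n + 1; the levels are mu 1, ..., mu K.+1.
   The other values of taus and mu are irrelevant. *)
Definition piecewise_constant n K (theta : 'I_n -> R)
    (taus : nat -> nat) (mu : nat -> R) : Prop :=
  [/\ taus 0%N = 1%N, taus K.+1 = n.+1,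
      forall k, (k <= K)%N -> (taus k < taus k.+1)%N,
      forall k, (1 <= k <= K)%N -> mu k != mu k.+1
    & forall k (i : 'I_n), (1 <= k <= K.+1)%N ->
        (taus k.-1 <= i.+1 < taus k)%N -> theta i = mu k].

Definition jump (mu : nat -> R) k : R := mu k.+1 - mu k.

Definition triplet := (nat * nat * nat)%type.

Definition T3 n : set triplet :=
  [set t | let: (t1, t2, t3) := t in (1 <= t1 < t2)%N && (t2 < t3 <= n.+1)%N].

Definition scale (t : triplet) : R := let: (t1, t2, t3) := t in
  Num.sqrt ((t2 - t1)%:R * (t3 - t2)%:R / (t3 - t1)%:R).

Definition log_term n (t : triplet) : R := let: (t1, t2, t3) := t in
  ln (n%:R * (t3 - t1)%:R / ((t3 - t2)%:R * (t2 - t1)%:R)).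

Definition lambda n (t : triplet) : R := Num.sqrt (2 * log_term n t).

Definition cusum n (y : 'I_n -> R) (t : triplet) : R :=
  let: (t1, t2, t3) := t in
  ((\sum_(i < n | (t2 <= i.+1 < t3)%N) y i) / (t3 - t2)%:R -
   (\sum_(i < n | (t1 <= i.+1 < t2)%N) y i) / (t2 - t1)%:R) * scale t.

Definition high_energy n (taus : nat -> nat) (mu : nat -> R) (kappa q : R) k
    : Prop :=
  let t := (taus k.-1, taus k, taus k.+1) in
  `|jump mu k| * scale t > kappa * Num.sqrt (2 * log_term n t + q).

Definition is_smallest (A : set R) (x : R) : Prop := A x /\ lbound A x.

Section Quantile.
Context d (Omega : measurableType d) (P : probability Omega R) (n : nat).
Variable eps : 'I_n -> {RV P >-> R}.

Definition noise (w : Omega) : 'I_n -> R := fun i => eps i w.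

Definition sup_noise (w : Omega) : R :=
  sup [set `|cusum (noise w) t| - lambda n t | t in T3 n].

(* The default value 0 plays no role: when T3 n is nonempty and 0 < alpha < 1,
   a smallest element exists by right-continuity of the tail function. *)
Definition zeta (alpha : R) : R :=
  xget 0 (is_smallest [set z | (P [set w | (sup_noise w > z)%R] <= alpha%:E)%E]).

Definition good_event (alpha : R) : set Omega :=
  [set w | forall t, T3 n t ->
    `|cusum (noise w) t| <= lambda n t + zeta alpha].

End Quantile.

(* Radii live in the positive integers extended by +oo, represented by None. *)
Definition le_radius (r s : option nat) : bool :=
  match r, s with
  | _, None => true
  | None, Some _ => false
  | Some r, Some s => (r <= s)%N
  end.

Definition window n (u : nat) (r : option nat) : triplet :=
  if r is Some r then (maxn (u - r) 1, u, minn (u + r) n.+1)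
  else (1%N, u, n.+1).

Section Pruning.
Variables (n : nat) (y : 'I_n -> R) (z : R).

Definition detects (u r : nat) : bool :=
  (1 <= r)%N &&
  (`|cusum y (window n u (Some r))| > lambda n (window n u (Some r)) + z).

Definition rhat (u : nat) : option nat :=
  if pselect (exists r, detects u r) is left H then Some (ex_minn H) else None.

(* The endpoints are integers, so that two such intervals intersect as real
   intervals if and only if they share an integer. *)
Definition conf_int (u : nat) : set nat :=
  let: (t1, _, t3) := window n u (rhat u) in
  [set x | (t1.+1 <= x <= t3.-1)%N].

(* Survivors of an ordered sequence.  The last entry is never examined, and
   the union ranges over all the later entries, removed or not. *)
Fixpoint survivors (s : seq nat) : seq nat :=
  match s with
  | [::] => [::]
  | [:: u] => [:: u]
  | u :: s' =>
    if (rhat u == None) ||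
       `[< conf_int u `&` \bigcup_(v in [set` s']) conf_int v !=set0 >]
    then survivors s' else u :: survivors s'
  end.

(* Relational because of ties: s is any ordering of tau along which rhat is
   nonincreasing. *)
Definition is_pruning (tau ptau : seq nat) : Prop :=
  exists s : seq nat,
    [/\ perm_eq s tau,
        sorted (fun u v => le_radius (rhat v) (rhat u)) s
      & ptau = [seq u <- tau | u \in survivors s]].

End Pruning.

Definition cp_vector n (tau : seq nat) : bool :=
  sorted ltn tau && all (fun u => (2 <= u <= n)%N) tau.

Definition dH1 (tau : seq nat) (u : nat) : \bar R :=
  \big[mine/+oo%E]_(v <- tau) (`|v%:R - u%:R| : R)%:E.

(* Number of entries in the real half-open interval ]a, b]; the entries of a
   change-point vector are distinct. *)
Definition nb_in_oc (a b : R) (tau : seq nat) : nat :=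
  count (fun u => a < u%:R <= b) tau.

Definition nb_in_cc (a b : R) (tau : seq nat) : nat :=
  count (fun u => a <= u%:R <= b) tau.

Definition midpoint (u v : nat) : R := (u%:R + v%:R) / 2.

End Model.

(* Main.v *)
Require Import Defs.
From HB Require Import structures.
From mathcomp Require Import all_boot all_order all_algebra.
From mathcomp Require Import all_classical all_reals all_analysis.
From mathcomp Require Import measurable_realfun ring lra zify.

(** On the good event a detection at [u] with radius [r] forces a true
   change-point into the interior of its window, since otherwise the CUSUM
   statistic is pure noise.  An interval containing a change-point also contains
   the change-point nearest to its centre, so two kept entries nearest to the
   same change-point would have intersecting intervals: this is (a).
   For (b), let [L] be the distance from [tau_k] to its neighbours and [u] the
   entry nearest to it, at distance [delta < L / 8].  With a radius [r > 2 delta]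
   the signal is at least [|Delta| sqrt r / (2 sqrt 2)], so detection occurs as
   soon as [Delta^2 r > 64 (2 log (2 n / r) + zeta^2)].  High energy makes the
   least such [r] satisfy [4 (r - 1) < L], and minimality makes [r - 1] at most
   [max (2 delta) (256 (log (n Delta^2) + zeta^2) / Delta^2)].  The last entry in
   the pruning order whose interval contains [tau_k] is kept: an interval meeting
   it without containing [tau_k] would have its own change-point within
   [4 (r - 1) < L] of [tau_k]. *)

Set Implicit Arguments.
Unset Strict Implicit.
Unset Printing Implicit Defensive.

Import Order.TTheory GRing.Theory Num.Theory.
Import numFieldNormedType.Exports.

Local Open Scope classical_set_scope.
Local Open Scope ring_scope.

(** * Existence of the quantile and probability of the good event *)

Section Quantile.
Context d (Omega : measurableType d) (R : realType) (P : probability Omega R).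

(** The tail function tends to 0 at [+oo], so the set is nonempty, and to 1 at [-oo], so it is
    bounded below; right-continuity puts the infimum into the set. *)
Lemma ccdf_has_smallest (X : {RV P >-> R}) (alpha : R) : 0 < alpha < 1 ->
  exists z, is_smallest [set z | (ccdf X z <= alpha%:E)%E] z.
Proof.
case/andP=> alpha_gt0 alpha_lt1; set A := [set z | _].
have A0 : A !=set0.
  have : \forall r \near +oo, (ccdf X r < alpha%:E)%E.
    apply: (@cvg_ccdfy0 _ _ _ _ X [set u | (u < alpha%:E)%E]).
    by apply: open_ereal_lt'; rewrite lte_fin.
  case=> M [_ /(_ (M + 1))]; rewrite ltrDl => /(_ ltr01) /ltW ?.
  by exists (M + 1).
have [m mP] : exists m, (alpha%:E < ccdf X m)%E.
  have : \forall r \near -oo, (alpha%:E < ccdf X r)%E.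
    apply: (@cvg_ccdfNy1 _ _ _ _ X [set u | (alpha%:E < u)%E]).
    by apply: open_ereal_gt'; rewrite lte_fin.
  by case=> M [_ /(_ (M - 1))]; rewrite gtrBl => /(_ ltr01) ?; exists (M - 1).
have Am : lbound A m.
  move=> a Aa; rewrite leNgt; apply/negP => /ltW /(ccdf_nonincreasing X).
  by move/(lt_le_trans mP)/lt_le_trans/(_ Aa); rewrite ltxx.
exists (inf A); split; last by move=> a; apply: ge_inf; exists m.
rewrite /A /= leNgt; apply/negP => infP.
have : \forall s \near (inf A)^'+, (alpha%:E < ccdf X s)%E.
  apply: (@ccdf_right_continuous _ _ _ _ X (inf A) [set u | (alpha%:E < u)%E]).
  exact: open_ereal_gt'.
move=> near_gt; have : \forall s \near (inf A)^'+, False.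
  near=> s.
  have [a Aa a_lt] : exists2 a, A a & a < s.
    by apply: inf_lt => //; near: s; exact: nbhs_right_gt.
  have : (alpha%:E < ccdf X s)%E by near: s.
  move/lt_le_trans/(_ (ccdf_nonincreasing X (ltW a_lt))).
  by move/lt_le_trans/(_ Aa); rewrite ltxx.
by move=> /filter_ex[].
Unshelve. all: by end_near. Qed.

Variables (n : nat) (eps : 'I_n -> {RV P >-> R}).

Lemma measurable_noise_sum (Q : pred 'I_n) :
  measurable_fun setT (fun w => \sum_(i < n | Q i) noise eps w i).
Proof.
pose h i w : R := if Q i then eps i w else 0.
rewrite (_ : (fun w => _) = (fun w => \sum_(i < n) h i w)).
  by apply: (@measurable_sum _ _ _ setT _ _ h) => i; rewrite /h; case: (Q i).
by apply/funext => w; rewrite big_mkcond.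
Qed.

Lemma measurable_cusum_noise t :
  measurable_fun setT (fun w => cusum (noise eps w) t).
Proof.
case: t => [[t1 t2] t3]; apply: measurable_funM => //.
by apply: measurable_funB; apply: measurable_funM => //; exact: measurable_noise_sum.
Qed.

Lemma finite_T3 : finite_set (T3 n).
Proof.
apply: (@sub_finite_set _ _ ((`I_n.+2 `*` `I_n.+2) `*` `I_n.+2)).
  move=> [[t1 t2] t3] /= /andP[/andP[_ t12] /andP[t23 t3n]].
  have t2n : (t2 < n.+2)%N by exact: leq_trans t23 (leqW t3n).
  by split=> //; split=> //; exact: ltn_trans t12 t2n.
by do 2 apply: finite_setX => //; exact: finite_II.
Qed.

Lemma finite_has_ubound (A : set R) : finite_set A -> has_ubound A.
Proof.
move=> /finite_seqP[s ->]; exists (\big[Num.max/0]_(x <- s) x) => x /= xs.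
exact: (@Order.TotalTheory.le_bigmax_seq _ _ _ s 0 x predT id xs).
Qed.

(** The triplet [(1, 2, 3)] makes the family nonempty and finiteness of [T3 n] bounds it, so that
    [sup] is a true least upper bound. *)
Lemma sup_noise_le w z : (1 < n)%N ->
  sup_noise eps w <= z <->
  forall t, T3 n t -> `|cusum (noise eps w) t| - lambda n t <= z.
Proof.
move=> n_gt1; rewrite /sup_noise; split=> [sup_le t Tt|le_z].
  apply: le_trans sup_le; apply: ub_le_sup; last by exists t.
  exact/finite_has_ubound/finite_image/finite_T3.
apply: ge_sup; last by move=> _ [t Tt <-]; exact: le_z.
by exists (`|cusum (noise eps w) (1, 2, 3)%N| - lambda n (1, 2, 3)%N), (1, 2, 3)%N.
Qed.

Lemma measurable_sup_noise : (1 < n)%N -> measurable_fun setT (sup_noise eps).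
Proof.
move=> n_gt1 mT; apply: (measurability _ (RGenOInfty.measurableE R)) => //.
move=> /= _ [_ [z ->] <-]; rewrite setTI.
rewrite [X in measurable X](_ : _ = ~` \bigcap_(t in T3 n)
    [set w | `|cusum (noise eps w) t| - lambda n t <= z]).
  apply/measurableC/fin_bigcap_measurable; first exact: finite_T3.
  move=> t _; rewrite -[X in measurable X]setTI.
  apply: (measurable_fun_ler _ _) => //.
  apply: measurable_funB => //; apply: measurableT_comp => //.
  exact: measurable_cusum_noise.
apply/seteqP; split=> w /=; rewrite in_itv /= andbT.
  by rewrite ltNge => /negP + /(sup_noise_le w z n_gt1).
by move=> nle; rewrite ltNge; apply/negP => /(sup_noise_le w z n_gt1).
Qed.

Lemma good_eventE alpha : (1 < n)%N ->
  good_event eps alpha = [set w | sup_noise eps w <= zeta eps alpha].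
Proof.
move=> n_gt1; apply/seteqP; split=> w /=.
  by move=> le_z; apply/sup_noise_le => // t Tt; rewrite lerBlDl; exact: le_z.
by move=> /sup_noise_le le_z t Tt; rewrite -lerBlDl; exact: le_z.
Qed.

Lemma good_event_prob alpha : (1 < n)%N -> 0 < alpha < 1 ->
  measurable (good_event eps alpha) /\
  ((1 - alpha)%:E <= P (good_event eps alpha))%E.
Proof.
move=> n_gt1 alpha01.
have mS : measurable_fun setT (sup_noise eps) by exact: measurable_sup_noise.
pose X : {RV P >-> R} := mfun_Sub (mem_set mS).
have XE z : ccdf X z = P [set w | sup_noise eps w > z].
  rewrite /ccdf /distribution /pushforward /=; congr (P _).
  by apply/seteqP; split=> w; rewrite /= in_itv /= andbT.
have [zeta_le _] : is_smallest
    [set z | (P [set w | (sup_noise eps w > z)%R] <= alpha%:E)%E] (zeta eps alpha).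
  have [z0 z0P] := ccdf_has_smallest X alpha01.
  (* A smallest element exists, so [xget] does not return its default value 0. *)
  apply: xgetPex; exists z0; move: z0P.
  by under eq_set do rewrite XE.
have mG : measurable [set w | sup_noise eps w <= zeta eps alpha].
  rewrite -[X in measurable X]setTI; apply: (measurable_fun_ler _ _) => //.
rewrite good_eventE //; split=> //.
rewrite (_ : [set _ | _] = ~` [set w | (sup_noise eps w > zeta eps alpha)%R]).
  rewrite probability_setC; last first.
    by rewrite -[X in measurable X]setTI; apply: (measurable_fun_ltr _ _) => //.
  by rewrite EFinB leeB.
by apply/seteqP; split=> w /=; rewrite leNgt => /negP.
Qed.

End Quantile.

(** * Order and location of the change-points *)

Section PiecewiseConstant.
Context {R : realType}.
Variables (n K : nat) (theta : 'I_n -> R) (taus : nat -> nat) (mu : nat -> R).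
Hypothesis pc : piecewise_constant K theta taus mu.

Lemma taus_lt i j : (i < j <= K.+1)%N -> (taus i < taus j)%N.
Proof.
have [_ _ incr _ _] := pc.
elim: j => [|j IHj]; first by rewrite ltn0.
case/andP; rewrite ltnS => ij jK; move: (incr j jK).
case: (ltngtP i j) ij => [ij _|//|-> _ //].
by apply: ltn_trans; apply: IHj; rewrite ij ltnW.
Qed.

Lemma taus_le i j : (i <= j <= K.+1)%N -> (taus i <= taus j)%N.
Proof.
case/andP; rewrite leq_eqVlt => /orP[/eqP-> //|ij jK].
by apply/ltnW/taus_lt; rewrite ij.
Qed.

Lemma taus_inner k : (1 <= k <= K)%N -> (2 <= taus k <= n)%N.
Proof.
have [t0 tK _ _ _] := pc => /andP[k1 kK].
have lo : (taus 0 < taus k)%N by apply: taus_lt; lia.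
have hi : (taus k < taus K.+1)%N by apply: taus_lt; lia.
by move: lo hi; rewrite t0 tK; lia.
Qed.

Lemma taus_segment p : (1 <= p <= n)%N ->
  exists2 k, (1 <= k <= K.+1)%N & (taus k.-1 <= p < taus k)%N.
Proof.
have [t0 tK _ _ _] := pc => /andP[p1 pn].
have ex : exists k, (p < taus k)%N by exists K.+1; rewrite tK ltnS.
case: (ex_minnP ex) => k pk min_k; exists k; last first.
  rewrite pk andbT; case: k pk min_k => [|k] pk min_k /=; first by rewrite t0.
  by rewrite leqNgt; apply/negP => /min_k; rewrite ltnn.
rewrite min_k ?tK ?ltnS // andbT; case: k pk {min_k} => //.
by rewrite t0 ltnS leqn0 => /eqP p0; rewrite p0 in p1.
Qed.

End PiecewiseConstant.

(** * Linearity of the CUSUM statistic and its vanishing on constant stretches *)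

Section Cusum.
Context {R : realType}.
Variable n : nat.
Implicit Types (f e : 'I_n -> R) (a b m : nat).

Lemma sum_segment f (c : R) a b : (1 <= a <= b)%N -> (b <= n.+1)%N ->
  (forall i : 'I_n, (a <= i.+1 < b)%N -> f i = c) ->
  \sum_(i < n | (a <= i.+1 < b)%N) f i = (b - a)%:R * c.
Proof.
move=> /andP[a1 ab] bn fE; rewrite (eq_bigr (fun=> c)) //.
(* Positions start at 1 and ordinals at 0, so both bounds drop by one. *)
transitivity (\sum_(a.-1 <= i < b.-1) c).
  rewrite (big_nat_widen _ _ n); last by lia.
  rewrite (big_nat_widenl _ 0) ?leq0n // big_mkord.
  by apply: eq_bigl => i; lia.
by rewrite sumr_const_nat mulr_natl; congr (_ *+ _); lia.
Qed.

Lemma sum_segment_cat f a m b : (a <= m <= b)%N ->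
  \sum_(i < n | (a <= i.+1 < b)%N) f i =
  \sum_(i < n | (a <= i.+1 < m)%N) f i + \sum_(i < n | (m <= i.+1 < b)%N) f i.
Proof.
move=> amb; rewrite (bigID (fun i : 'I_n => (i.+1 < m)%N)) /=.
by congr (_ + _); apply: eq_bigl => i; lia.
Qed.

Lemma cusumD f e t : cusum (fun i => f i + e i) t = cusum f t + cusum e t.
Proof.
case: t => [[t1 t2] t3] /=; rewrite !big_split /= !mulrDl opprD.
by rewrite addrACA mulrDl.
Qed.

Lemma cusum_constant f c t1 t2 t3 : T3 n (t1, t2, t3) ->
  (forall i : 'I_n, (t1 <= i.+1 < t3)%N -> f i = c) -> cusum f (t1, t2, t3) = 0.
Proof.
case/andP=> /andP[t1_ge1 t12] /andP[t23 t3n] fE; rewrite /cusum.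
rewrite !(@sum_segment _ c); try lia; try by move=> i ?; apply: fE; lia.
rewrite ![_ * c]mulrC !mulfK ?subrr ?mul0r // pnatr_eq0; lia.
Qed.

End Cusum.

(** * Confidence intervals and the pruning order *)

Section Radius.
Context {R : realType}.
Variables (n : nat) (y : 'I_n -> R) (z : R).

Lemma rhatP u r : rhat y z u = Some r ->
  detects y z u r /\ forall r', detects y z u r' -> (r <= r')%N.
Proof.
rewrite /rhat; case: pselect => // ex [<-].
by case: ex_minnP => m ? min_m; split.
Qed.

Lemma rhat_detects u r : detects y z u r ->
  exists2 r', rhat y z u = Some r' & (r' <= r)%N.
Proof.
move=> det; rewrite /rhat; case: pselect => [ex|[]]; last by exists r.
by case: ex_minnP => m ? min_m; exists m => //; exact: min_m.
Qed.

Lemma window_T3 u r : (2 <= u <= n)%N -> (1 <= r)%N -> T3 n (window n u (Some r)).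
Proof. by move=> un r1; rewrite /T3 /window /=; lia. Qed.

(** The first two conditions say [|u - x| < r] without truncated subtraction; clipping the window at
    1 and [n + 1] leaves only [2 <= x <= n]. *)
Lemma conf_intP u r x : (2 <= u <= n)%N -> rhat y z u = Some r ->
  conf_int y z u x <-> [&& (u < x + r)%N, (x < u + r)%N & (2 <= x <= n)%N].
Proof.
move=> un rE; have [/andP[r1 _] _] := rhatP rE.
by rewrite /conf_int rE /window /=; split; lia.
Qed.

Lemma survivors_sub s : {subset survivors y z s <= s}.
Proof.
elim: s => [//|u [|v s] IHs] w //=; case: ifP => _.
  by move=> /IHs ws; rewrite inE ws orbT.
by rewrite inE => /orP[/eqP->|/IHs ws]; rewrite inE ?eqxx // ws orbT.
Qed.

Lemma le_radius_refl : reflexive le_radius.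
Proof. by case=> [r|] //=; exact: leqnn. Qed.

Let desc := [rel u v | le_radius (rhat y z v) (rhat y z u)].

Lemma desc_trans : transitive desc.
Proof.
move=> v u w /=; case: (rhat y z u) (rhat y z v) (rhat y z w) => [?|] [?|] [?|] //=.
by move=> vu /leq_trans; apply.
Qed.

(** The earlier of two survivors was examined against all later intervals, hence is finite and
    disjoint from the other. The later one has a finite radius even if it comes last, since radii do
    not increase along [s]. *)
Lemma survivors_disjoint s : sorted desc s ->
  {in survivors y z s &, forall u v, u != v ->
     rhat y z u != None /\ ~ (conf_int y z u `&` conf_int y z v !=set0)}.
Proof.
elim: s => [//|a s IHs].
rewrite /= (path_sortedE desc_trans) => /andP[/allP a_top s_sorted] u v.
case: s IHs a_top s_sorted => [|b s] IHs a_top s_sorted.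
  by rewrite !inE => /eqP-> /eqP->; rewrite eqxx.
move: IHs => /(_ s_sorted) IHs; case: ifPn => [_|]; first exact: IHs.
rewrite negb_or => /andP[a_fin /asboolPn disj].
have a_disj w : w \in b :: s -> ~ (conf_int y z a `&` conf_int y z w !=set0).
  by move=> ws [x [ax wx]]; apply: disj; exists x; split=> //; exists w.
rewrite !inE => /orP[/eqP->|us] /orP[/eqP->|vs]; rewrite ?eqxx // => uv.
- by split=> //; exact/a_disj/survivors_sub.
- have ub := survivors_sub us; split; last by rewrite setIC; exact: a_disj.
  move: (a_top _ ub) a_fin => /=.
  by case: (rhat y z u) (rhat y z a) => [?|] [?|].
- exact: IHs.
Qed.

(** Here [v] is the last entry of [s] whose interval contains [x]. If [v] is removed, its interval
    meets that of a later [w], which misses [x] by the choice of [v]. *)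
Lemma survivor_near s x u : sorted desc s -> u \in s ->
  rhat y z u != None -> conf_int y z u x ->
  exists v, [/\ v \in s, le_radius (rhat y z v) (rhat y z u), conf_int y z v x &
    v \in survivors y z s \/
    exists w, [/\ w \in s, le_radius (rhat y z w) (rhat y z u),
      ~ conf_int y z w x & conf_int y z v `&` conf_int y z w !=set0]].
Proof.
elim: s u => [//|a s IHs] u.
rewrite [sorted _ _]/= (path_sortedE desc_trans) => /andP[/allP a_top s_sorted].
(* The induction hypothesis, carried from [s] to [a :: s]. *)
have tailP v : v \in s -> rhat y z v != None -> conf_int y z v x ->
    le_radius (rhat y z v) (rhat y z u) ->
  exists v, [/\ v \in a :: s, le_radius (rhat y z v) (rhat y z u), conf_int y z v x &
    v \in survivors y z (a :: s) \/
    exists w, [/\ w \in a :: s, le_radius (rhat y z w) (rhat y z u),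
      ~ conf_int y z w x & conf_int y z v `&` conf_int y z w !=set0]].
  move=> vs v_fin vx vu.
  have [v' [v's v'v v'x alt]] := IHs v s_sorted vs v_fin vx.
  exists v'; split=> //; first by rewrite inE v's orbT.
    exact: (desc_trans vu).
  case: alt => [surv|[w [ws wv wx vw]]]; [left|right].
    case: s s_sorted {IHs a_top vs v's} surv => // b s _ surv.
    by rewrite /=; case: ifP => // _; rewrite inE surv orbT.
  by exists w; split=> //; [rewrite inE ws orbT | exact: (desc_trans vu)].
rewrite inE => /orP[/eqP uE|us] u_fin ux; last first.
  by apply: (tailP u) => //; exact: le_radius_refl.
move: u_fin ux tailP; rewrite {u}uE => u_fin ux tailP.
have [[v vs vx]|no_v] := pselect (exists2 v, v \in s & conf_int y z v x).
  have vu := a_top v vs; apply: (tailP v) => //.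
  by move: vu u_fin => /=; case: (rhat y z v) (rhat y z a) => [?|] [?|].
exists a; split=> //; first by rewrite inE eqxx.
- exact: le_radius_refl.
case: s IHs a_top s_sorted tailP no_v => [|b s] _ a_top _ _ no_v /=.
  by left; rewrite inE.
case: ifP => [|_]; last by left; rewrite inE eqxx.
rewrite (negPf u_fin) /= => /asboolP[x' [ax' [w ws wx']]]; right.
exists w; split=> //; [by rewrite inE ws orbT|exact: a_top| |by exists x'].
by move=> wx; apply: no_v; exists w.
Qed.
End Radius.

(** * What a detection implies on the good event *)

Section Detection.
Context {R : realType}.
Variables (n K : nat) (theta e : 'I_n -> R) (taus : nat -> nat) (mu : nat -> R).
Variable z : R.
Hypothesis pc : piecewise_constant K theta taus mu.
Hypothesis good : forall t, T3 n t -> `|cusum e t| <= lambda n t + z.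
Let y i : R := theta i + e i.

Lemma detects_change u r : (2 <= u <= n)%N -> detects y z u r ->
  exists2 j, (1 <= j <= K)%N & (u < taus j + r)%N && (taus j < u + r)%N.
Proof.
have [t0 tK _ _ thetaE] := pc => un /andP[r1 det].
have wT := window_T3 un r1; apply/not_exists2P => no_j.
suff : cusum theta (window n u (Some r)) = 0.
  move=> c0; move: det; rewrite cusumD c0 add0r ltNge => /negP; apply.
  exact: good.
(* The segment holding the left end of the window covers all of it: otherwise its right end [taus k]
   would be a change-point inside the window. *)
have [|k kK /andP[klo khi]] := taus_segment pc (p := maxn (u - r) 1); first by lia.
apply: (@cusum_constant _ _ _ (mu k)) => // i /andP[ilo ihi].
apply: (thetaE k) => //; rewrite (leq_trans klo) //=.
have [kK'|Kk] := leqP k K; last first.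
  by have -> : k = K.+1 by [lia]; rewrite tK; lia.
have [|/negP] := no_j k; first by lia.
by have := taus_inner pc (k := k); lia.
Qed.

Lemma conf_int_change u r : (2 <= u <= n)%N -> rhat y z u = Some r ->
  exists2 j, (1 <= j <= K)%N & conf_int y z u (taus j).
Proof.
move=> un rE; have [det _] := rhatP rE.
have [j jK uj] := detects_change un det; exists j => //.
by apply/(conf_intP _ un rE); rewrite andbA uj (taus_inner pc).
Qed.

(** The midpoint conditions make [taus k] at least as close to [u] as any other change-point, so it
    lies in the interval as soon as one of them does. The guards reflect that [taus 0] and
    [taus K.+1] are not change-points. *)
Lemma conf_int_nearest u r k : (2 <= u <= n)%N -> (1 <= k <= K)%N ->
  rhat y z u = Some r ->
  ((1 < k)%N -> (taus k.-1 + taus k < u.*2)%N) ->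
  ((k < K)%N -> (u.*2 <= taus k + taus k.+1)%N) ->
  conf_int y z u (taus k).
Proof.
move=> un kK rE left_k right_k; have [j jK] := conf_int_change un rE.
have kn := taus_inner pc kK; rewrite !(conf_intP _ un rE).
case: (ltngtP j k) => [jk|kj|-> //].
  have lej := @taus_le _ _ _ _ _ _ pc j k.-1 ltac:(lia).
  have lek := @taus_le _ _ _ _ _ _ pc k.-1 k ltac:(lia).
  by have := left_k ltac:(lia); lia.
have lej := @taus_le _ _ _ _ _ _ pc k.+1 j ltac:(lia).
have lek := @taus_le _ _ _ _ _ _ pc k k.+1 ltac:(lia).
by have := right_k ltac:(lia); lia.
Qed.

End Detection.

(** * Counting, midpoints and distances *)

Lemma count_le1 (T : eqType) (A : pred T) (s : seq T) : uniq s ->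
  {in s &, forall u v, A u -> A v -> u = v} -> (count A s <= 1)%N.
Proof.
elim: s => [//|a s IHs] /= /andP[a_s s_uniq] AE.
have := IHs s_uniq; case: (boolP (A a)) => Aa; last first.
  by apply=> u v us vs; apply: AE; rewrite inE ?us ?vs orbT.
move=> _; suff : ~~ has A s by rewrite has_count -leqNgt leqn0 => /eqP->.
apply/hasPn => v vs; apply/negP => Av; move: a_s.
by rewrite (AE a v) ?vs // inE ?eqxx ?vs ?orbT.
Qed.

Section Midpoint.
Context {R : realType}.

Lemma lt_midpoint (a b u : nat) : ((midpoint a b : R) < u%:R) = (a + b < u.*2)%N.
Proof. by rewrite /midpoint ltr_pdivrMr // -natrD -natrM ltr_nat muln2. Qed.

Lemma le_midpoint (a b u : nat) : (u%:R <= (midpoint a b : R)) = (u.*2 <= a + b)%N.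
Proof. by rewrite leNgt lt_midpoint -leqNgt. Qed.

End Midpoint.

Section Dist.
Context {R : realType}.

(** One of the two truncated differences vanishes; distances thus become linear integer
    expressions. *)
Lemma distn_natr (u v : nat) : `|u%:R - v%:R| = ((u - v) + (v - u))%:R :> R.
Proof.
wlog uv : u v / (u <= v)%N => [wl|].
  by case/orP: (leq_total u v) => /wl // E; rewrite distrC E addnC.
by rewrite distrC -natrB // ger0_norm //; congr _%:R; lia.
Qed.

Lemma dH1_le (tau : seq nat) (x v : nat) : v \in tau ->
  (dH1 tau x <= (`|v%:R - x%:R| : R)%:E)%E.
Proof.
rewrite /dH1; elim: tau => [//|a tau IHtau]; rewrite inE big_cons ge_min.
by move=> /orP[/eqP->|/IHtau ->]; rewrite ?lexx ?orbT.
Qed.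

Lemma dH1_attained (tau : seq nat) (x : nat) : (dH1 tau x < +oo :> \bar R)%E ->
  exists2 u, u \in tau & dH1 tau x = (`|u%:R - x%:R| : R)%:E.
Proof.
rewrite /dH1; elim: tau => [|a tau IHtau]; first by rewrite big_nil ltxx.
rewrite big_cons; set rest := \big[_/_]_(_ <- _) _.
have [le_a _|lt_a rest_fin] := leP (`|a%:R - x%:R| : R)%:E rest.
  by exists a; rewrite ?inE ?eqxx.
by have [u us uE] := IHtau rest_fin; exists u; rewrite ?inE ?us ?orbT.
Qed.

End Dist.

(** * Size of the signal and a sufficient condition for detection *)

Section Signal.
Context {R : realType}.
Variables (n : nat) (theta e : 'I_n -> R) (z : R).
Variables (lo c hi : nat) (m1 m2 : R).
Hypotheses (lo1 : (1 <= lo <= c)%N) (hin : (c <= hi <= n.+1)%N).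
Hypothesis thetaL : forall i : 'I_n, (lo <= i.+1 < c)%N -> theta i = m1.
Hypothesis thetaR : forall i : 'I_n, (c <= i.+1 < hi)%N -> theta i = m2.

Lemma windowE u r : (lo + r <= u)%N -> (u + r <= hi)%N ->
  window n u (Some r) = (u - r, u, u + r)%N.
Proof. by move=> lou uhi; congr (_, _, _); lia. Qed.

Lemma scale_window u r : (1 <= r <= u)%N ->
  scale (u - r, u, u + r)%N = Num.sqrt (r%:R / 2) :> R.
Proof.
move=> ru; rewrite /scale; congr Num.sqrt.
have -> : (u - (u - r) = r)%N by lia.
have -> : (u + r - u = r)%N by lia.
have -> : (u + r - (u - r) = 2 * r)%N by lia.
have r0 : r%:R != 0 :> R by rewrite pnatr_eq0; lia.
by rewrite natrM; field.
Qed.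

(** With [d] the distance from [u] to [c], one half of the window is constant and the other has [d]
    entries at that same level and [r - d] at the other level, so the averages differ by a fraction
    [(r - d) / r] of the jump. *)
Lemma cusum_signal u r : (1 <= r)%N -> (lo + r <= u)%N -> (u + r <= hi)%N ->
  ((u - c) + (c - u) <= r)%N ->
  `|cusum theta (u - r, u, u + r)%N| =
    `|m2 - m1| * ((r%:R - ((u - c) + (c - u))%:R) / r%:R) * Num.sqrt (r%:R / 2).
Proof.
move=> r1 lou uhi near_c; rewrite /cusum scale_window; last by lia.
have r0 : r%:R != 0 :> R by rewrite pnatr_eq0; lia.
rewrite normrM [`|Num.sqrt _|]ger0_norm ?sqrtr_ge0 //; congr (_ * _).
have -> : (u - (u - r) = r)%N by lia.
have -> : (u + r - u = r)%N by lia.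
set d := ((u - c) + (c - u))%N.
have rd : 0 <= (r%:R - d%:R) / r%:R :> R.
  by rewrite divr_ge0 // subr_ge0 ler_nat.
rewrite -[in RHS](ger0_norm rd) -normrM; congr `|_|.
have [uc|cu] := leqP u c.
  rewrite (@sum_segment_cat _ _ _ u c (u + r)); last by lia.
  rewrite (@sum_segment _ _ _ m1 u c); try lia; try by move=> i ?; apply: thetaL; lia.
  rewrite (@sum_segment _ _ _ m1 (u - r)); try lia; try by move=> i ?; apply: thetaL; lia.
  rewrite (@sum_segment _ _ _ m2); try lia; try by move=> i ?; apply: thetaR; lia.
  have -> : (c - u = d)%N by lia.
  have -> : (u + r - c = r - d)%N by lia.
  have -> : (u - (u - r) = r)%N by lia.
  by rewrite natrB //; field.
rewrite (@sum_segment_cat _ _ _ (u - r) c u); last by lia.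
rewrite (@sum_segment _ _ _ m1 (u - r)); try lia; try by move=> i ?; apply: thetaL; lia.
rewrite (@sum_segment _ _ _ m2 c); try lia; try by move=> i ?; apply: thetaR; lia.
rewrite (@sum_segment _ _ _ m2 u); try lia; try by move=> i ?; apply: thetaR; lia.
have -> : (u - c = d)%N by lia.
have -> : (c - (u - r) = r - d)%N by lia.
have -> : (u + r - u = r)%N by lia.
by rewrite natrB //; field.
Qed.

Hypothesis good : forall t, T3 n t -> `|cusum e t| <= lambda n t + z.

(* Nothing is assumed on the sign of [z]: only
   [(lambda + z) ^ 2 <= 2 (lambda ^ 2 + z ^ 2)] is used. *)
Lemma detects_large_signal u r : (1 <= r)%N -> (lo + r <= u)%N -> (u + r <= hi)%N ->
  (2 * ((u - c) + (c - u)) <= r)%N ->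
  64 * (2 * ln (2 * n%:R / r%:R) + z ^+ 2) < (m2 - m1) ^+ 2 * r%:R ->
  detects (fun i => theta i + e i) z u r.
Proof.
move=> r1 lou uhi near_c large; rewrite /detects r1 andTb windowE //.
set t := (u - r, u, u + r)%N.
have tT : T3 n t by rewrite /T3 /=; lia.
have r_gt0 : 0 < r%:R :> R by rewrite ltr0n; lia.
have n_gt0 : 0 < n%:R :> R by rewrite ltr0n; lia.
have logE : log_term n t = ln (2 * n%:R / r%:R) :> R.
  rewrite /log_term /t; congr ln.
  have -> : (u - (u - r) = r)%N by lia.
  have -> : (u + r - u = r)%N by lia.
  have -> : (u + r - (u - r) = 2 * r)%N by lia.
  by rewrite natrM; field; rewrite gt_eqF.
have log_ge0 : 0 <= ln (2 * n%:R / r%:R) :> R.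
  apply: ln_ge0; rewrite ler_pdivlMr // mul1r -natrM ler_nat; lia.
have lam2 : lambda n t ^+ 2 = 2 * ln (2 * n%:R / r%:R) :> R.
  by rewrite /lambda sqr_sqrtr logE // mulr_ge0.
set lam := lambda n t in lam2 *; set l := ln _ in log_ge0 lam2 large.
(* The factor 1/2 bounds [(r - d) / r] from below, because [2 d <= r]. *)
pose sig : R := `|m2 - m1| / 2 * Num.sqrt (r%:R / 2).
have sig_le : sig <= `|cusum theta t|.
  rewrite cusum_signal //; last by lia.
  rewrite ler_wpM2r ?sqrtr_ge0 // ler_wpM2l ?normr_ge0 //.
  rewrite ler_pdivlMr //.
  move: near_c; rewrite -(ler_nat R) natrM; lra.
have sig0 : 0 <= sig by rewrite mulr_ge0 ?sqrtr_ge0 // divr_ge0 ?normr_ge0.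
have sig2 : sig ^+ 2 = (m2 - m1) ^+ 2 * r%:R / 8.
  rewrite exprMn expr_div_n sqr_sqrtr ?divr_ge0 // -normrX ger0_norm ?sqr_ge0 //.
  by field.
(* Twice the threshold: the noise can cancel one [lam + z], and more than one must remain. Squaring
   explains the 64, namely 8 from [sig2], 4 from the square of 2, and 2 from the square of a sum. *)
have sig_gt : 2 * (lam + z) < sig.
  rewrite ltNge; apply/negP => sig_small.
  have : sig ^+ 2 <= (2 * (lam + z)) ^+ 2 by rewrite lerXn2r ?nnegrE //; lra.
  have : 0 <= (lam - z) ^+ 2 by exact: sqr_ge0.
  rewrite sig2; move: large lam2; rewrite !expr2; nra.
have e_le := good tT; rewrite cusumD.
have := lerB_normD (cusum theta t) (cusum e t).
rewrite -/lam in e_le *; lra.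
Qed.

End Signal.

(** * Choice of the radius from the high-energy condition *)

Section Energy.
Context {R : realType}.

Lemma ln2_ge : 2^-1 <= ln 2 :> R.
Proof.
have := @le_ln1Dx R (- 2^-1) ltac:(lra).
by rewrite (_ : 1 - 2^-1 = 2^-1 :> R); [rewrite lnV ?posrE //; lra|lra].
Qed.

(* The constants: [26 ^ 2 / 4 = 169], and [n / s <= 4 n / L] gives
   [2 n / s <= 2 ^ 3 (n / L)], whence [ln (2 n / s) <= 5 / 2 g] and
   [64 * 2 * 5 / 2 <= 2 * 169]. *)
Lemma radius_exists (D2 z2 g : R) (n L dist : nat) :
  (0 < L <= n)%N -> (8 * dist < L)%N -> 0 <= z2 ->
  ln 4 <= g -> ln (n%:R / L%:R) <= g -> 26 ^+ 2 * (2 * g + z2) < D2 * L%:R ->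
  exists r, [/\ (2 * dist < r)%N, (r + dist <= L)%N, (4 * r.-1 < L)%N,
    64 * (2 * ln (2 * n%:R / r%:R) + z2) < D2 * r%:R
    & (r.-1 <= 2 * dist)%N \/ D2 * r.-1%:R <= 256 * (ln (n%:R * D2) + z2)].
Proof.
move=> /andP[L0 Ln] dL.
have dL2 : (2 * dist < L)%N by lia.
have L4 : (L <= 4 * L)%N by lia.
have small_r r : (r.-1 <= 2 * dist)%N -> (r + dist <= L)%N /\ (4 * r.-1 < L)%N by lia.
have large_r r : (2 * dist < r.-1)%N -> (4 * r.-1 < L)%N -> (r + dist <= L)%N by lia.
have pred_r r : (2 * dist < r.-1)%N -> (0 < r.-1)%N /\ (r.-1 < r)%N by lia.
move=> z2_ge0 g_ge4 g_geL energy.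
have L_gt0 : 0 < L%:R :> R by rewrite ltr0n.
have n_gt0 : 0 < n%:R :> R by rewrite ltr0n (leq_trans L0).
have LnR : L%:R <= n%:R :> R by rewrite ler_nat.
have ln2 := ln2_ge.
have ln4 : ln 4 = 2 * ln 2 :> R by rewrite (natrX _ 2 2) lnXn // mulr_natl.
have ln8 : ln 8 = 3 * ln 2 :> R by rewrite (natrX _ 2 3) lnXn // mulr_natl.
have D2_gt0 : 0 < D2 by rewrite -(pmulr_lgt0 _ L_gt0); lra.
have nD2 : 2 <= n%:R * D2.
  have : D2 * L%:R <= D2 * n%:R by rewrite ler_pM2l.
  rewrite [n%:R * _]mulrC; lra.
have ln_nD2 : ln 2 <= ln (n%:R * D2) by rewrite ler_ln ?posrE //; lra.
pose F r := 64 * (2 * ln (2 * n%:R / r%:R) + z2) < D2 * r%:R.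
have F_large s : (0 < s)%N -> (L <= 4 * s)%N -> F s.
  move=> s0 Ls; have s_gt0 : 0 < s%:R :> R by rewrite ltr0n.
  have LsR : L%:R <= 4 * s%:R :> R by rewrite -natrM ler_nat.
  have : ln (2 * n%:R / s%:R) <= ln (8 * (n%:R / L%:R)) :> R.
    rewrite ler_ln ?posrE ?mulr_gt0 ?divr_gt0 ?mulr_gt0 ?invr_gt0 //.
    rewrite ler_pdivrMr // !mulrA mulrAC ler_pdivlMr // -!mulrA.
    by rewrite [_ * L%:R]mulrC; nra.
  rewrite [ln (8 * _)]lnM ?posrE ?divr_gt0 // /F => ?.
  have : D2 * L%:R <= D2 * (4 * s%:R) by rewrite ler_pM2l.
  lra.
have ex : exists r, (2 * dist < r)%N && F r.
  by exists L; rewrite dL2; exact: F_large.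
(* Take the least admissible [r]. Either [r - 1] is at most [2 * dist], or it violates [F] by
   minimality, which bounds it by [L / 4] through [F_large] and by the logarithmic term. *)
case: (ex_minnP ex) => r /andP[dr Fr] r_min; exists r.
have [r_small|r_large] := leqP r.-1 (2 * dist).
  by have [? ?] := small_r r r_small; split=> //; left.
have [r1 r1r] := pred_r r r_large.
have nF : ~~ F r.-1.
  apply/negP => Fr1; have := r_min r.-1.
  by rewrite r_large Fr1 leqNgt r1r => /(_ isT).
have r4 : (4 * r.-1 < L)%N.
  by rewrite ltnNge; apply: contra nF; exact: F_large.
split=> //; first exact: large_r.
right; move: nF; rewrite /F -leNgt; set s := r.-1 in r1 *.
have s_gt0 : 0 < s%:R :> R by rewrite ltr0n.
(* If [D2 * s < 1], the bound holds since [256 * ln 2 >= 128]. Otherwise [1 / s <= D2], so [ln (2 *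
   n / s) <= ln 2 + ln (n * D2) <= 2 * ln (n * D2)], and [64 * 2 * 2 = 256]. *)
have [x_ge1|x_lt1] := lerP 1 (D2 * s%:R); last by lra.
have : ln (2 * n%:R / s%:R) <= ln (2 * (n%:R * D2)).
  rewrite ler_ln ?posrE ?divr_gt0 ?mulr_gt0 //.
  by rewrite ler_pdivrMr // -!mulrA ler_pM2l // ler_peMr // ltW.
rewrite [ln (2 * (_ * _))]lnM ?posrE ?mulr_gt0 //; lra.
Qed.

(** This trades the two segment lengths for their minimum, since [a b / (a + b) <= min(a, b) <= a b
    * 2 / (a + b)]; only the left inequality, [4 a b <= (a + b)^2] and [a + b <= n] enter. *)
Lemma high_energyE (n a b : nat) (D k z g : R) : (0 < a)%N -> (0 < b)%N ->
  (a + b <= n)%N -> 0 <= k ->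
  g = ln (n%:R * (a + b)%:R / (b%:R * a%:R)) ->
  k * Num.sqrt (2 * g + z ^+ 2) < `|D| * Num.sqrt (a%:R * b%:R / (a + b)%:R) ->
  [/\ ln 4 <= g, ln (n%:R / (minn a b)%:R) <= g &
      k ^+ 2 * (2 * g + z ^+ 2) < D ^+ 2 * (minn a b)%:R].
Proof.
move=> a0 b0 abn k0 gE energy.
have aR : 0 < a%:R :> R by rewrite ltr0n.
have bR : 0 < b%:R :> R by rewrite ltr0n.
have abR : 0 < (a + b)%:R :> R by rewrite ltr0n; lia.
have nR : (a + b)%:R <= n%:R :> R by rewrite ler_nat.
have n_gt0 : 0 < n%:R :> R by apply: lt_le_trans nR.
have minR : 0 < (minn a b)%:R :> R by rewrite ltr0n; lia.
have le_min : a%:R * b%:R / (a + b)%:R <= (minn a b)%:R :> R.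
  rewrite ler_pdivrMr // -!natrM ler_nat.
  by case: (leqP a b) => ab; nia.
have arg_gt0 : 0 < n%:R * (a + b)%:R / (b%:R * a%:R) :> R.
  by rewrite divr_gt0 ?mulr_gt0.
have g4 : ln 4 <= g.
  rewrite gE ler_ln ?posrE // ler_pdivlMr ?mulr_gt0 //.
  rewrite natrD in nR abR *.
  have : 0 <= (a%:R - b%:R) ^+ 2 :> R by exact: sqr_ge0.
  have : (a%:R + b%:R) * (a%:R + b%:R) <= n%:R * (a%:R + b%:R) :> R.
    by rewrite ler_pM2r.
  rewrite expr2; lra.
split=> //.
  have min_ge1 : 1 <= (a + b)%:R / (b%:R * a%:R) * (minn a b)%:R :> R.
    rewrite mulrAC ler_pdivlMr ?mulr_gt0 // mul1r [b%:R * _]mulrC [leRHS]mulrC.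
    by rewrite -ler_pdivrMr.
  rewrite gE ler_ln ?posrE // ?divr_gt0 // ler_pdivrMr //.
  by rewrite -[n%:R * _ / _]mulrA -mulrA ler_peMr // ltW.
(* Nonnegativity is what lets the square root square back to its argument. *)
have g0 : 0 <= 2 * g + z ^+ 2.
  have := @ln2_ge; have : 0 <= ln 4 :> R by rewrite ln_ge0 //; lra.
  have := sqr_ge0 z; lra.
have s0 : 0 <= a%:R * b%:R / (a + b)%:R :> R by rewrite divr_ge0 ?mulr_ge0.
have : (k * Num.sqrt (2 * g + z ^+ 2)) ^+ 2 <
    (`|D| * Num.sqrt (a%:R * b%:R / (a + b)%:R)) ^+ 2.
  by rewrite ltrXn2r ?nnegrE // ?mulr_ge0 ?sqrtr_ge0 ?normr_ge0.
rewrite !exprMn !sqr_sqrtr // -normrX [`|D ^+ 2|]ger0_norm ?sqr_ge0 //.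
by move/lt_le_trans; apply; rewrite ler_wpM2l ?sqr_ge0.
Qed.

End Energy.

(** * The two guarantees on the pruned vector *)

Section Pruning.
Context {R : realType}.
Variables (n K : nat) (theta e : 'I_n -> R) (taus : nat -> nat) (mu : nat -> R).
Variable z : R.
Hypothesis pc : piecewise_constant K theta taus mu.
Hypothesis good : forall t, T3 n t -> `|cusum e t| <= lambda n t + z.
Let y i : R := theta i + e i.
Variables tau ptau : seq nat.
Hypothesis tau_cp : cp_vector n tau.
Hypothesis tau_ptau : is_pruning y z tau ptau.

Lemma cp_vector_range u : u \in tau -> (2 <= u <= n)%N.
Proof. by have /andP[_ /allP tau_n] := tau_cp; exact: tau_n. Qed.

(** The predicate [A] is left abstract to treat the inner ranges and the two outer ones at once: the
    intervals of two kept entries in [A] would share [taus k]. *)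
Lemma pruning_no_spurious (A : pred nat) k : (1 <= k <= K)%N ->
  (forall u, A u -> (1 < k)%N -> (taus k.-1 + taus k < u.*2)%N) ->
  (forall u, A u -> (k < K)%N -> (u.*2 <= taus k + taus k.+1)%N) ->
  (count A ptau <= 1)%N.
Proof.
move=> kK A_left A_right.
have [s [s_tau s_sorted ->]] := tau_ptau.
have tau_uniq : uniq tau.
  by have /andP[/(sorted_uniq ltn_trans ltnn)] := tau_cp.
apply: count_le1; first exact: filter_uniq.
move=> u v; rewrite !mem_filter => /andP[us utau] /andP[vs vtau] Au Av.
apply/eqP/negPn/negP => uv.
have [u_fin disj] := survivors_disjoint s_sorted us vs uv.
have [v_fin _] := survivors_disjoint s_sorted vs us ltac:(by rewrite eq_sym).
apply: disj; exists (taus k).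
move: u_fin v_fin; case ru: (rhat y z u) => [r|//] _.
case rv: (rhat y z v) => [r'|//] _.
split.
- by apply: (conf_int_nearest pc good _ kK ru);
    [exact: cp_vector_range|exact: A_left|exact: A_right].
- by apply: (conf_int_nearest pc good _ kK rv);
    [exact: cp_vector_range|exact: A_left|exact: A_right].
Qed.

Lemma pruning_near k u r : (1 <= k <= K)%N -> u \in tau ->
  ((u - taus k) + (taus k - u) < r)%N ->
  (r + ((u - taus k) + (taus k - u)) <=
     minn (taus k - taus k.-1) (taus k.+1 - taus k))%N ->
  (4 * r.-1 < minn (taus k - taus k.-1) (taus k.+1 - taus k))%N ->
  detects y z u r ->
  exists2 v, v \in ptau & ((v - taus k) + (taus k - v) <= r.-1)%N.
Proof.
move=> kK utau d_r rd_L r_L det.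
have un := cp_vector_range utau.
have [s [s_tau s_sorted ptauE]] := tau_ptau.
have mem_s v : v \in s -> (2 <= v <= n)%N.
  by rewrite (perm_mem s_tau); exact: cp_vector_range.
have [t0 tK _ _ _] := pc.
have kn := taus_inner pc kK.
have isolated j : (1 <= j <= K)%N ->
    (taus j <= taus k.-1)%N || (taus k.+1 <= taus j)%N || (j == k).
  move=> jK; case: (ltngtP j k) => jk; last by rewrite !orbT.
    by rewrite (@taus_le _ _ _ _ _ _ pc j k.-1) //; lia.
  by rewrite (@taus_le _ _ _ _ _ _ pc k.+1 j) ?orbT //; lia.
have [r0 rE r0r] := rhat_detects det.
(* The interval of [u] contains some change-point, and all but [taus k] are at distance at least [r]
   from [u]. *)
have u_k : conf_int y z u (taus k).
  have [j jK] := conf_int_change pc good un rE.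
  have := isolated j jK; rewrite !(conf_intP _ un rE) => /orP[far|/eqP-> //].
  by lia.
have us : u \in s by rewrite (perm_mem s_tau).
have [|v [vs vu vk alt]] := survivor_near s_sorted us _ u_k; first by rewrite rE.
move: vu; rewrite rE; case rv: (rhat y z v) => [r1|//] /= r1r0.
have vn := mem_s v vs.
have dv : ((v - taus k) + (taus k - v) < r1)%N.
  by move: vk; rewrite (conf_intP _ vn rv); lia.
exists v; last by lia.
case: alt => [vsurv|[w [ws wu wk [x []]]]].
  by rewrite ptauE mem_filter vsurv -(perm_mem s_tau).
(* The interval of [w] contains a change-point other than [taus k]. Going from [taus k] to [v], to
   the common point [x], to [w], to that change-point takes four steps of length at most [r - 1],
   less than the gap between change-points. *)
move: wu; rewrite rE; case rw: (rhat y z w) => [r2|//] /= r2r0.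
have wn := mem_s w ws; have [j jK] := conf_int_change pc good wn rw.
have := isolated j jK; move: wk.
rewrite !(conf_intP _ wn rw) (conf_intP _ vn rv).
by move=> wk /orP[far|/eqP jk]; [lia|rewrite jk].
Qed.

Lemma pruning_high_energy k : (1 <= k <= K)%N ->
  high_energy n taus mu 26 (z ^+ 2) k ->
  (dH1 tau (taus k) <
     ((minn (taus k - taus k.-1) (taus k.+1 - taus k))%:R / 8 : R)%:E)%E ->
  (dH1 ptau (taus k) <=
     maxe (2%:E * dH1 tau (taus k))
       (256 * ((ln (n%:R * jump mu k ^+ 2) + z ^+ 2) / jump mu k ^+ 2))%:E)%E.
Proof.
move=> kK energy near_k.
have [u utau distE] := dH1_attained (lt_trans near_k (ltry _)).
move: near_k; rewrite distE distn_natr lte_fin; set dist := ((u - _) + _)%N.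
rewrite ltr_pdivlMr // -natrM ltr_nat => near_k.
have [t0 tK _ mu_neq thetaE] := pc.
have un := cp_vector_range utau.
have lo_k : (1 <= taus k.-1 < taus k)%N.
  have := @taus_le _ _ _ _ _ _ pc 0 k.-1 ltac:(lia).
  have := @taus_lt _ _ _ _ _ _ pc k.-1 k ltac:(lia).
  by rewrite t0; lia.
have hi_k : (taus k < taus k.+1 <= n.+1)%N.
  have := @taus_le _ _ _ _ _ _ pc k.+1 K.+1 ltac:(lia).
  have := @taus_lt _ _ _ _ _ _ pc k k.+1 ltac:(lia).
  by rewrite tK; lia.
set a := (taus k - taus k.-1)%N in near_k *.
set b := (taus k.+1 - taus k)%N in near_k *.
have abE : (a + b = taus k.+1 - taus k.-1)%N by rewrite /a /b; lia.
have [a0 b0 abn] : [/\ (0 < a)%N, (0 < b)%N & (a + b <= n)%N].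
  by split; rewrite /a /b; lia.
have Ln : (0 < minn a b <= n)%N by lia.
have inside r : (2 * dist < r)%N -> (r + dist <= minn a b)%N ->
    [/\ (1 <= r)%N, (taus k.-1 + r <= u)%N, (u + r <= taus k.+1)%N & (dist < r)%N].
  by rewrite /a /b /dist => *; split; lia.
have k1 : (1 <= k <= K.+1)%N && (1 <= k.+1 <= K.+1)%N by lia.
rewrite mulnC in near_k.
move: energy; rewrite /high_energy /scale /log_term -abE => energy.
have [g4 gL D2L] := high_energyE a0 b0 abn (ler0n _ 26) erefl energy.
have [r [dr rd r4 F alt]] := radius_exists Ln near_k (sqr_ge0 z) g4 gL D2L.
have [r1 lo_u u_hi d_r] := inside r dr rd.
have det : detects y z u r.
  have [/andP[lo1 lo_c] /andP[c_hi hi_n]] := conj lo_k hi_k.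
  have [k1K k2K] := andP k1.
  apply: (@detects_large_signal _ _ _ _ _ (taus k.-1) (taus k) (taus k.+1)
    (mu k) (mu k.+1)) => //; try exact: ltnW.
  - by rewrite lo1 ltnW.
  - by rewrite ltnW.
  - by move=> i ik; exact: (thetaE k).
  - by move=> i ik; exact: (thetaE k.+1).
have [v vp dv] := pruning_near kK utau d_r rd r4 det.
apply: (le_trans (dH1_le _ vp)); rewrite distn_natr -EFinM le_max !lee_fin.
case: alt => [r_d|r_D]; apply/orP; [left|right].
  by rewrite -natrM ler_nat (leq_trans dv).
(* Consecutive levels differ, so the bound may be divided by the squared jump. *)
have D2_gt0 : 0 < jump mu k ^+ 2.
  by rewrite exprn_even_gt0 //= subr_eq0 eq_sym mu_neq.
rewrite mulrA ler_pdivlMr // mulrC; apply: le_trans r_D.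
by rewrite ler_pM2l // ler_nat.
Qed.

End Pruning.

Theorem proposition12 (R : realType) :
  exists kappa c : R, [/\ 0 < kappa, 0 < c &
  forall (d : measure_display) (Omega : measurableType d)
    (P : probability Omega R) (n : nat) (eps : 'I_n -> {RV P >-> R}),
    mutually_independent eps -> centered eps -> subgaussian eps ->
  forall alpha : R, 0 < alpha < 1 ->
  forall K : nat, (1 <= K)%N ->
  forall (theta : 'I_n -> R) (taus : nat -> nat) (mu : nat -> R),
    piecewise_constant K theta taus mu ->
  let z := zeta eps alpha in
  [/\ measurable (good_event eps alpha),
      ((1 - alpha)%:E <= P (good_event eps alpha))%E &
  forall w : Omega, good_event eps alpha w ->
  let y := fun i : 'I_n => theta i + eps i w in
  forall tau : seq nat, cp_vector n tau ->
  forall ptau : seq nat, is_pruning y z tau ptau ->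
  [/\ forall k, (2 <= k <= K.-1)%N ->
        (nb_in_oc (midpoint (taus k.-1) (taus k) : R)
                  (midpoint (taus k) (taus k.+1)) ptau <= 1)%N,
      (nb_in_cc (2 : R) (midpoint (taus 1%N) (taus 2%N)) ptau <= 1)%N,
      (nb_in_oc (midpoint (taus K.-1) (taus K)) (n%:R : R) ptau <= 1)%N
    & forall k, (1 <= k <= K)%N ->
        high_energy n taus mu kappa (z ^+ 2) k ->
        (dH1 tau (taus k) <
           ((minn (taus k - taus k.-1) (taus k.+1 - taus k))%:R / 8 : R)%:E)%E ->
        (dH1 ptau (taus k) <=
           maxe (2%:E * dH1 tau (taus k))
             (c * ((ln (n%:R * jump mu k ^+ 2) + z ^+ 2) / jump mu k ^+ 2))%:E)%E]]].
Proof.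
exists 26, 256; split; [exact: ltr0n|exact: ltr0n|].
move=> d Omega P n eps _ _ _ alpha alpha01 K K1 theta taus mu pc z.
(* One change-point in [2, ..., n] suffices to make [T3 n] nonempty. *)
have n_gt1 : (1 < n)%N.
  by have := taus_inner pc (k := 1) ltac:(by rewrite K1); lia.
have [mG PG] := good_event_prob eps n_gt1 alpha01; split=> // w good y.
move=> tau tau_cp ptau tau_ptau.
have no_spurious := pruning_no_spurious pc good tau_cp tau_ptau.
split; last by move=> k kK; exact: (pruning_high_energy pc good tau_cp tau_ptau kK).
- move=> k kK; apply: (no_spurious _ k); first by lia.
  + by move=> u /andP[]; rewrite lt_midpoint.
  + by move=> u /andP[_]; rewrite le_midpoint.
(* For the outer ranges, [k = 1] and [k = K], the guard on the outer side is false. *)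
- apply: (no_spurious _ 1%N) => //.
  by move=> u /andP[_]; rewrite le_midpoint.
- apply: (no_spurious _ K) => [|u /andP[]|u _]; rewrite ?lt_midpoint ?ltnn ?K1 ?leqnn //.
Qed.
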